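(* Let $P\subset\mathbb{R}^d$ be a polytope and $Z=Z(Q,\mu)\in\mathcal{Z}_n(\mathbb{R}^d)$ be such that (1) $Z$ is a general position zonotope, and (2) each vertex of $P$ is Hausdorff stable relative to $Z$ and each vertex of $Z$ is Hausdorff stable relative to $P$. Let $d_P(Z)$ be achieved at the $k$ distinct pairs of points $(p_1,q_1),\dots,(p_k,q_k)\in P\times Z$. For each $q_i$ let $e_i=\mathrm{Lift}(q_i)$ be the (unique) lift of $q_i$ to $I^n$. Define $$\mathcal{C}(P,Z)=\{(\Delta Q,\Delta\mu)\in\mathbb{R}^{d\times n}\times\mathbb{R}^d \mid \langle \Delta Q\,e_i+\Delta\mu,\ p_i-q_i\rangle\ge 0\ \ \forall i\}.$$ Then $\mathcal{C}(P,Z)$ is a polyhedral cone, and for any $(\Delta Q,\Delta\mu)$ in the interior of $\mathcal{C}(P,Z)$ there exists $\epsilon>0$ such that for all $0<t<\epsilon$ the perturbed zonotope $Z_t=Z(Q+t\Delta Q,\mu+t\Delta\mu)$ satisfies $d_P(Z_t)<d_P(Z)$.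
   Context: For a matrix $Q\in\mathbb{R}^{d\times n}$ with columns $g_1,\dots,g_n$ (the generators) and $\mu\in\mathbb{R}^d$, let $A(x)=Qx+\mu$, $I^n=[0,1]^n$, and let $Z(Q,\mu)=A(I^n)$ be the associated zonotope. $\mathcal{Z}_n(\mathbb{R}^d)$ is the quotient of the space of pairs $(Q,\mu)$ by the action of $S_n$ permuting the columns of $Q$. A zonotope is a general position zonotope if its generators are in general position (any subset of at most $d$ of them is linearly independent). For such $Z$, each $q\in\partial Z$ has a unique preimage $\mathrm{Lift}(q)\in A^{-1}(q)\cap I^n$. $d(P,Z)=\max(\sup_{p\in P}d(p,Z),\sup_{z\in Z}d(z,P))$ is the Hausdorff distance (Euclidean norm), and $d_P(Z)=d(P,Z)$. $\Pi(x,W)$ is the Euclidean nearest point to $x$ in $W$. A pair $(p,q)\in P\times Z$ achieves the Hausdorff distance if $\|p-q\|_2=d(P,Z)$ and either $p$ is a vertex of $P$ and $q=\Pi(p,Z)$, or $q$ is a vertex of $Z$ and $p=\Pi(q,P)$; $(p_1,q_1),\dots,(p_k,q_k)$ are all such pairs. For a polytope $X\subset\mathbb{R}^d$, a point $x\notin X^\circ$ (the interior) is Hausdorff stable relative to $X$ if $x-\Pi(x,X)$ lies in the relative interior of the normal cone to $X$ at $\Pi(x,X)$; every point $x\in X^\circ$ is also Hausdorff stable relative to $X$. *)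

(* Defs.v *)
From mathcomp Require Import all_boot all_order all_algebra.
From mathcomp Require Import all_classical all_reals all_analysis.

Set Implicit Arguments.
Unset Strict Implicit.
Unset Printing Implicit Defensive.

Import Order.TTheory GRing.Theory Num.Theory.
Import numFieldNormedType.Exports.
Local Open Scope classical_set_scope.
Local Open Scope ring_scope.

(* The norm that MathComp-Analysis puts on matrices is the sup norm, so the
   Euclidean inner product and norm are introduced here.  Both norms induce
   the same topology, so the library's [interior] on ['cV[R]_d] and on pairs
   is the usual one. *)
Definition dot (R : realType) (d : nat) (u v : 'cV[R]_d) : R :=
  \sum_(i < d) u i ord0 * v i ord0.

Definition enorm (R : realType) (d : nat) (u : 'cV[R]_d) : R :=
  Num.sqrt (dot u u).

Definition dist_set (R : realType) (d : nat) (x : 'cV[R]_d)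
    (W : set 'cV[R]_d) : R :=
  inf [set enorm (x - w) | w in W].

Definition hausdorff_dist (R : realType) (d : nat) (P Z : set 'cV[R]_d) : R :=
  Num.max (sup [set dist_set p Z | p in P]) (sup [set dist_set z P | z in Z]).

(* The nearest point exists and is unique when W is nonempty, closed and
   convex; when no nearest point exists the value is 0. *)
Definition proj (R : realType) (d : nat) (x : 'cV[R]_d)
    (W : set 'cV[R]_d) : 'cV[R]_d :=
  xget 0 [set y | W y /\ forall w, W w -> enorm (x - y) <= enorm (x - w)].

Definition convex_hull (R : realType) (d : nat) (X : set 'cV[R]_d) :
    set 'cV[R]_d :=
  [set y | exists (m : nat) (a : 'I_m -> R) (x : 'I_m -> 'cV[R]_d),
     [/\ forall i, X (x i), forall i, 0 <= a i, \sum_(i < m) a i = 1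
       & y = \sum_(i < m) a i *: x i]].

Definition affine_hull (R : realType) (d : nat) (X : set 'cV[R]_d) :
    set 'cV[R]_d :=
  [set y | exists (m : nat) (a : 'I_m -> R) (x : 'I_m -> 'cV[R]_d),
     [/\ forall i, X (x i), \sum_(i < m) a i = 1
       & y = \sum_(i < m) a i *: x i]].

Definition relative_interior (R : realType) (d : nat) (X : set 'cV[R]_d) :
    set 'cV[R]_d :=
  [set x | X x /\ exists2 eps : R, 0 < eps &
     forall y, affine_hull X y -> enorm (y - x) < eps -> X y].

(* Polytopes are nonempty but need not be full-dimensional. *)
Definition polytope (R : realType) (d : nat) (P : set 'cV[R]_d) : Prop :=
  exists V : set 'cV[R]_d, [/\ finite_set V, V !=set0 & P = convex_hull V].

Definition vertex (R : realType) (d : nat) (X : set 'cV[R]_d)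
    (v : 'cV[R]_d) : Prop :=
  X v /\ forall (a b : 'cV[R]_d) (t : R), X a -> X b -> 0 < t < 1 ->
    v = t *: a + (1 - t) *: b -> a = v /\ b = v.

Definition normal_cone (R : realType) (d : nat) (X : set 'cV[R]_d)
    (y : 'cV[R]_d) : set 'cV[R]_d :=
  [set c | forall x, X x -> dot c (x - y) <= 0].

Definition hausdorff_stable (R : realType) (d : nat) (X : set 'cV[R]_d)
    (x : 'cV[R]_d) : Prop :=
  X° x \/
  (~ X° x /\ relative_interior (normal_cone X (proj x X)) (x - proj x X)).

Definition unit_cube (R : realType) (n : nat) : set 'cV[R]_n :=
  [set e | forall j, 0 <= e j ord0 <= 1].
Arguments unit_cube : clear implicits.

Definition zonotope (R : realType) (d n : nat) (Q : 'M[R]_(d, n))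
    (mu : 'cV[R]_d) : set 'cV[R]_d :=
  [set Q *m e + mu | e in unit_cube R n].

Definition general_position (R : realType) (d n : nat) (Q : 'M[R]_(d, n)) :
    Prop :=
  forall S : {set 'I_n}, (#|S| <= d)%N -> free [seq col j Q | j in S].

(* The preimage of q in the unit cube; it is unique when Q is in general
   position and q lies on the boundary of the zonotope. *)
Definition zonotope_lift (R : realType) (d n : nat) (Q : 'M[R]_(d, n))
    (mu q : 'cV[R]_d) : 'cV[R]_n :=
  xget 0 [set e | unit_cube R n e /\ Q *m e + mu = q].

Definition achieves_hausdorff (R : realType) (d : nat) (P Z : set 'cV[R]_d)
    (p q : 'cV[R]_d) : Prop :=
  [/\ P p, Z q, enorm (p - q) = hausdorff_dist P Z
    & (vertex P p /\ q = proj p Z) \/ (vertex Z q /\ p = proj q P)].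

Definition improving_cone (R : realType) (d n k : nat)
    (e : 'I_k -> 'cV[R]_n) (p q : 'I_k -> 'cV[R]_d) :
    set ('M[R]_(d, n) * 'cV[R]_d) :=
  [set D | forall i, 0 <= dot (D.1 *m e i + D.2) (p i - q i)].

Definition polyhedral_cone (R : realType) (V : lmodType R) (C : set V) : Prop :=
  exists (m : nat) (f : 'I_m -> {scalar V}), C = [set x | forall i, 0 <= f i x].

(* Main.v *)
From HB Require Import structures.
Require Import Defs.
From mathcomp Require Import all_boot all_order all_algebra.
From mathcomp Require Import all_classical all_reals all_analysis.
From mathcomp Require Import ring lra.

Set Implicit Arguments.
Unset Strict Implicit.
Unset Printing Implicit Defensive.

Import Order.TTheory GRing.Theory Num.Theory.
Import numFieldNormedType.Exports.
Local Open Scope classical_set_scope.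
Local Open Scope ring_scope.

(** Write [D] for the Hausdorff distance.  The distance to a convex set is a
    convex function, so both suprema that define [D] are governed by finitely
    many points: the vertices of [P] on one side, the images [A(e)] of the
    vertices [e] of the cube on the other.  This stays true for [Z_t], whose
    generating points [A_t(e)] move affinely in [t].  Hence it is enough to
    find, for each of these finitely many points and all small [t > 0], a point
    of the other body at distance less than [D] ([hausdorff_dist_lt]).

    If the point is at distance less than [D] at time 0, continuity is enough.
    If it is at distance exactly [D], it belongs to one of the pairs
    [(p_i, q_i)].  The material point with lift [e_i] moves with velocity
    [v_i = DQ e_i + Dmu], so that [p_i - q_i] becomes [p_i - q_i - t v_i], whose
    norm decreases to first order as soon as [<v_i, p_i - q_i> > 0]
    ([enorm_descent]).  That strict inequality is what membership in the
    interior of the cone gives, provided [p_i <> q_i]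
    ([improving_cone_interior]).

    Two points need an argument.

    - A vertex [e] of the cube whose image [w = A(e)] is at distance [D] from
      [P] must give a vertex of [Z], with lift [e].  Put [p] for the point of
      [P] nearest to [w] and [c = w - p].  Since no point of [Z] is further from
      [P], [w] maximises [<c, .>] on [Z] ([sup_dist_normal]).  At most [d - 1]
      generators are orthogonal to [c], and they are independent; the other
      coordinates of a lift of [w] are forced by maximality.  So [w] has the
      single lift [e], and an extreme point with a single lift maps to an
      extreme point ([general_position_vertex]).

    - [D > 0].  Otherwise [P = Z]; this body has two distinct points because
      the generators are nonzero, and then the point farthest from a given
      point is a vertex that is not Hausdorff stable relative to the body
      itself ([convex_hull_farthest_not_stable]). *)

(* Importing the analysis library hides the nearest-point map. *)
Local Notation proj := Defs.proj.

(** * The Euclidean norm *)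

Section Euclid.
Variables (R : realType) (d : nat).
Implicit Types (u v w x y : 'cV[R]_d) (a M t : R).

Lemma dotC u v : dot u v = dot v u.
Proof. by apply: eq_bigr => i _; rewrite mulrC. Qed.

Lemma dotDl u v w : dot (u + v) w = dot u w + dot v w.
Proof. by rewrite /dot -big_split; apply: eq_bigr => i _; rewrite mxE mulrDl. Qed.

Lemma dotZl a u v : dot (a *: u) v = a * dot u v.
Proof. by rewrite /dot mulr_sumr; apply: eq_bigr => i _; rewrite mxE mulrA. Qed.

Lemma dotNl u v : dot (- u) v = - dot u v.
Proof. by rewrite -scaleN1r dotZl mulN1r. Qed.

Lemma dotDr u v w : dot u (v + w) = dot u v + dot u w.
Proof. by rewrite dotC dotDl !(dotC u). Qed.

Lemma dotZr a u v : dot u (a *: v) = a * dot u v.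
Proof. by rewrite dotC dotZl dotC. Qed.

Lemma dotNr u v : dot u (- v) = - dot u v.
Proof. by rewrite dotC dotNl dotC. Qed.

Definition dotE := (dotDl, dotDr, dotNl, dotNr, dotZl, dotZr).

Lemma dot0l u : dot 0 u = 0.
Proof. by rewrite -(scale0r u) dotZl mul0r. Qed.

Lemma dot_ge0 u : 0 <= dot u u.
Proof. by apply: sumr_ge0 => i _; rewrite -expr2 sqr_ge0. Qed.

Lemma dot_eq0 u : (dot u u == 0) = (u == 0).
Proof.
apply/eqP/eqP => [|->]; last by rewrite dot0l.
move/psumr_eq0P => u0; apply/matrixP => i j; rewrite !mxE ord1.
by apply/eqP; rewrite -sqrf_eq0 expr2 u0 // => k _; rewrite -expr2 sqr_ge0.
Qed.

Lemma enorm_ge0 u : 0 <= enorm u.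
Proof. exact: sqrtr_ge0. Qed.

Lemma sqr_enorm u : enorm u ^+ 2 = dot u u.
Proof. by rewrite sqr_sqrtr ?dot_ge0. Qed.

Lemma enormN u : enorm (- u) = enorm u.
Proof. by rewrite /enorm dotNl dotNr opprK. Qed.

Lemma enormBC u v : enorm (u - v) = enorm (v - u).
Proof. by rewrite -enormN opprB. Qed.

Lemma enorm0 : enorm (0 : 'cV[R]_d) = 0.
Proof. by rewrite /enorm dot0l sqrtr0. Qed.

Lemma enorm_le M u : 0 <= M -> (enorm u <= M) = (dot u u <= M ^+ 2).
Proof. by move=> M0; rewrite -sqr_enorm ler_sqr ?nnegrE ?enorm_ge0. Qed.

Lemma enorm_lt M u : 0 <= M -> (enorm u < M) = (dot u u < M ^+ 2).
Proof. by move=> M0; rewrite -sqr_enorm ltr_sqr ?nnegrE ?enorm_ge0. Qed.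

Lemma enorm_le0 u : enorm u <= 0 -> u = 0.
Proof.
rewrite enorm_le // expr0n /= => u0; apply/eqP.
by rewrite -dot_eq0 eq_le u0 dot_ge0.
Qed.

(** The defect [t (1 - t) |u - v|^2] is the uniform convexity of the squared
    norm: it gives convexity of thickenings and, later, that a farthest point is
    extreme. *)
Lemma dot_comb t u v :
  dot (t *: u + (1 - t) *: v) (t *: u + (1 - t) *: v) =
  t * dot u u + (1 - t) * dot v v - t * (1 - t) * dot (u - v) (u - v).
Proof. by rewrite !dotE (dotC v u); ring. Qed.

Lemma continuous_enorm : continuous (@enorm R d).
Proof.
have sqcont (i : 'I_d) : continuous (fun u : 'cV[R]_d => u i ord0 * u i ord0).
  by move=> u; apply: (@cvgM _ _ (nbhs u)); exact: coord_continuous.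
have dotcont : continuous (fun u : 'cV[R]_d => dot u u).
  by apply: continuous_big => [|i _]; [exact: add_continuous | exact: sqcont].
move=> u; apply: (@continuous_comp _ _ _ (fun u : 'cV[R]_d => dot u u) Num.sqrt).
  exact: dotcont.
exact: sqrt_continuous.
Qed.

Lemma continuous_enormB x : continuous (fun w => enorm (x - w)).
Proof.
move=> w; apply: (@continuous_comp _ _ _ (fun w : 'cV[R]_d => x - w) (@enorm R d)).
  by apply: (@cvgB _ _ _ (nbhs w)); [exact: cvg_cst | exact: cvg_id].
exact: continuous_enorm.
Qed.

(** The derivative of [|u - t v|^2] at [t = 0] is [-2 <v, u>]. *)
Lemma enorm_descent M u v : 0 < M ->
  enorm u < M \/ enorm u = M /\ 0 < dot v u ->
  \forall t \near 0^'+, enorm (u - t *: v) < M.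
Proof.
move=> M0 H.
have sq t : dot (u - t *: v) (u - t *: v) =
    dot u u - t * (dot v u *+ 2 - t * dot v v).
  by rewrite !dotE (dotC u v); ring.
case: H => [uM|[uM uv]].
  have cvgu : (fun t : R => enorm (u - t *: v)) @ 0^'+ --> enorm (u - 0 *: v).
    apply: cvg_at_right_filter.
    apply: (@continuous_comp _ _ _ (fun t : R => u - t *: v) (@enorm R d));
      last exact: continuous_enorm.
    apply: cvgB; first exact: cvg_cst.
    by apply: cvgZr_tmp; exact: cvg_id.
  rewrite scale0r subr0 in cvgu.
  exact: cvgr_lt uM.
have v0 : 0 < dot v v.
  rewrite lt_neqAle dot_ge0 andbT eq_sym dot_eq0.
  by apply/eqP => v0; rewrite v0 dot0l ltxx in uv.
near=> t.
have t0 : 0 < t by near: t; exact: nbhs_right_gt.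
have tt : t < dot v u / dot v v by near: t; apply: nbhs_right_lt; rewrite divr_gt0.
rewrite ltr_pdivlMr // in tt.
rewrite (enorm_lt _ (ltW M0)) -uM sqr_enorm sq gtrDl oppr_lt0 mulr_gt0 //; lra.
Unshelve. all: by end_near. Qed.

End Euclid.

(** * Convex sets and convex hulls *)

Section Convexity.
Variables (R : realType) (d : nat).
Implicit Types (u v w x y : 'cV[R]_d) (a M t : R) (X W Y : set 'cV[R]_d).

Definition convexset W := forall x y t,
  W x -> W y -> 0 <= t <= 1 -> W (t *: x + (1 - t) *: y).

Lemma convex_hull_convex X : convexset (convex_hull X).
Proof.
move=> _ _ t [m [a [x [xX a0 a1 ->]]]] [k [b [y [yX b0 b1 ->]]]] /andP[t0 t1].
exists (m + k)%N,
  (fun i => match fintype.split i with inl j => t * a j | inr j => (1 - t) * b j end),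
  (fun i => match fintype.split i with inl j => x j | inr j => y j end).
have splitl j : fintype.split (lshift k j : 'I_(m + k)) = inl j by exact: (unsplitK (inl j)).
have splitr j : fintype.split (rshift m j : 'I_(m + k)) = inr j by exact: (unsplitK (inr j)).
split=> [i|i||]; rewrite ?big_split_ord /=.
- by case: fintype.split.
- by case: fintype.split => j; rewrite mulr_ge0 // subr_ge0.
- under eq_bigr do rewrite splitl.
  under [X in _ + X]eq_bigr do rewrite splitr.
  by rewrite -!mulr_sumr a1 b1 !mulr1 subrKC.
- under [in RHS]eq_bigr do rewrite splitl.
  under [X in _ = _ + X]eq_bigr do rewrite splitr.
  rewrite !scaler_sumr.
  by congr (_ + _); apply: eq_bigr => j _; rewrite scalerA.
Qed.

Lemma sub_convex_hull X : X `<=` convex_hull X.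
Proof.
move=> x Xx; exists 1%N, (fun=> 1), (fun=> x).
by split=> //; rewrite big_ord1 // scale1r.
Qed.

Lemma convex_hull_min X W : convexset W -> X `<=` W -> convex_hull X `<=` W.
Proof.
move=> cW XW _ [m [a [x [xX a0 a1 ->]]]].
suff H : forall m (a : 'I_m -> R) (x : 'I_m -> 'cV[R]_d),
    (forall i, W (x i)) -> (forall i, 0 <= a i) -> 0 < \sum_(i < m) a i ->
    W ((\sum_(i < m) a i)^-1 *: \sum_(i < m) a i *: x i).
  have := H m a x (fun i => XW _ (xX i)) a0.
  by rewrite a1 invr1 scale1r; apply; exact: ltr01.
clear m a x xX a0 a1 => m; elim: m => [|m IH] a x xW a0.
  by rewrite big_ord0 ltxx.
rewrite !big_ord_recr /=; set s := \sum_(i < m) _; set b := a ord_max.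
have s0 : 0 <= s by exact: sumr_ge0.
have b0 : 0 <= b by exact: a0.
move=> sb; have [s_eq0|s_gt0] := eqVneq s 0.
  have az : forall i : 'I_m, a (widen_ord (leqnSn m) i) = 0.
    by move/psumr_eq0P: s_eq0 => + i => ->.
  rewrite big1 => [|i _]; last by rewrite az scale0r.
  rewrite s_eq0 !add0r scalerA mulVf ?scale1r //.
  by move: sb; rewrite s_eq0 add0r => /gt_eqF ->.
have s_gt0' : 0 < s by rewrite lt_neqAle eq_sym s_gt0.
have := IH _ _ (fun i => xW (widen_ord (leqnSn m) i)) (fun i => a0 _) s_gt0'.
rewrite -/s => Ws.
have := cW _ _ (s / (s + b)) Ws (xW ord_max).
rewrite divr_ge0 ?ler_pdivrMr ?mul1r ?lerDl ?addr_ge0 //= => /(_ b0).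
rewrite scalerDr !scalerA; have sb0 : s + b != 0 by rewrite gt_eqF.
have -> : s / (s + b) / s = (s + b)^-1 by field; rewrite sb0.
by have -> : 1 - s / (s + b) = (s + b)^-1 * b by field.
Qed.

(** The cone with apex [v] and base [W]; through it, hulls of finite sets are
    built by adding one point at a time. *)
Definition cone_over v W : set 'cV[R]_d :=
  [set z.1 *: v + (1 - z.1) *: z.2 | z in `[0%R, 1%R]%classic `*` W].

Lemma cone_over_convex v W : convexset W -> convexset (cone_over v W).
Proof.
move=> cW _ _ t [[a x] [/= /[!in_itv] /= /andP[a0 a1] Wx] <-]
  [[b y] [/= /[!in_itv]/= /andP[b0 b1] Wy] <-] /andP[t0 t1].
set g := t * a + (1 - t) * b.
have p1 : 0 <= t * (1 - a) by rewrite mulr_ge0 // subr_ge0.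
have p2 : 0 <= (1 - t) * (1 - b) by rewrite mulr_ge0 // subr_ge0.
have p3 : 0 <= t * a by rewrite mulr_ge0.
have p4 : 0 <= (1 - t) * b by rewrite mulr_ge0 // subr_ge0.
have g1E : 1 - g = t * (1 - a) + (1 - t) * (1 - b) by rewrite /g; ring.
have [g1|g1] := eqVneq (1 - g) 0.
  exists (1, x) => /=; first by rewrite in_itv /= ler01 lexx.
  have q1 : t * (1 - a) = 0 by lra.
  have q2 : (1 - t) * (1 - b) = 0 by lra.
  rewrite subrr scale0r addr0 scale1r !scalerDr !scalerA q1 q2 !scale0r !addr0.
  rewrite -scalerDl -/g; have -> : g = 1 by lra.
  by rewrite scale1r.
have g1p : 0 < 1 - g by rewrite lt_neqAle eq_sym g1 g1E addr_ge0.
set s := t * (1 - a) / (1 - g).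
exists (g, s *: x + (1 - s) *: y) => /=.
  split; first by rewrite /= in_itv /= -subr_ge0 subr0 addr_ge0 //= -subr_ge0 ltW.
  by apply: cW => //; rewrite ler_pdivrMr // mul1r g1E lerDl p2 divr_ge0 ?(ltW g1p).
rewrite /= !scalerDr !scalerA scalerDl -!addrA; congr (_ + _).
have sE : (1 - g) * s = t * (1 - a) by rewrite /s; field.
have -> : (1 - g) * (1 - s) = (1 - t) * (1 - b).
  by rewrite mulrBr mulr1 sE g1E; ring.
by rewrite sE addrCA.
Qed.

Lemma convex_hull_setU1 v X : X !=set0 ->
  convex_hull (v |` X) `<=` cone_over v (convex_hull X).
Proof.
move=> [x0 Xx0]; apply: convex_hull_min => [|x [->|Xx]].
- exact/cone_over_convex/convex_hull_convex.
- exists (1, x0) => /=; last by rewrite scale1r subrr scale0r addr0.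
  by split; [rewrite /= in_itv /= ler01 lexx | exact: sub_convex_hull].
- exists (0, x) => /=; last by rewrite scale0r add0r subr0 scale1r.
  by split; [rewrite /= in_itv /= ler01 lexx | exact: sub_convex_hull].
Qed.

Lemma cone_over_sub v X W : convexset W -> W v -> X `<=` W -> cone_over v X `<=` W.
Proof.
move=> cW Wv XW _ [[a x] [/= /[!in_itv]/= a01 Xx] <-].
by apply: cW => //; exact: XW.
Qed.

Lemma subset_convex_hull X Y : X `<=` Y -> convex_hull X `<=` convex_hull Y.
Proof.
move=> XY; apply: convex_hull_min; first exact: convex_hull_convex.
by move=> x /XY; exact: sub_convex_hull.
Qed.

Lemma set_consE v (s : seq 'cV[R]_d) : [set` v :: s] = v |` [set` s].
Proof.
apply/seteqP; split=> x /=; first by rewrite inE => /orP[/eqP|]; [left|right].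
by rewrite inE => -[->|->]; rewrite ?eqxx ?orbT.
Qed.

Lemma convex_hull_seq1 v : convex_hull [set` [:: v]] = [set v].
Proof.
apply/seteqP; split=> [|x ->]; last by apply: sub_convex_hull; rewrite /= inE.
apply: convex_hull_min => [x y t -> -> _|x /=]; last by rewrite inE => /eqP.
by rewrite -scalerDl subrKC scale1r.
Qed.

Lemma cone_over_compact v W : compact W -> compact (cone_over v W).
Proof.
move=> cptW; apply: continuous_compact; last first.
  by apply: compact_setX => //; exact: segment_compact.
apply: continuous_subspaceT => z.
apply: (@cvgD _ _ _ (nbhs z)).
  apply: (@cvgZr_tmp _ _ _ (nbhs z)); exact: cvg_fst.
apply: (@cvgZ _ _ _ (nbhs z)); last exact: cvg_snd.
by apply: (@cvgB _ _ _ (nbhs z)); [exact: cvg_cst | exact: cvg_fst].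
Qed.

(** The hull of [v :: s] is the cone with apex [v] over the hull of [s], a
    continuous image of the product of a segment and a compact set. *)
Lemma convex_hull_seq_compact (s : seq 'cV[R]_d) : compact (convex_hull [set` s]).
Proof.
elim: s => [|v [|w s] IH].
- suff -> : convex_hull [set` ([::] : seq 'cV[R]_d)] = set0 by exact: compact0.
  by rewrite -subset0; apply: convex_hull_min.
- by rewrite convex_hull_seq1; exact: compact_set1.
suff -> : convex_hull [set` v :: w :: s] = cone_over v (convex_hull [set` w :: s]).
  exact: cone_over_compact.
rewrite set_consE; apply/seteqP; split.
  by apply: convex_hull_setU1; exists w; rewrite /= mem_head.
apply: cone_over_sub; first exact: convex_hull_convex.
  by apply: sub_convex_hull; left.
by apply: subset_convex_hull; right.
Qed.

(** Minkowski's theorem for a finite set.  Points that lie in the hull of the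
    others are removed until none is left.  Then each remaining [v] is extreme:
    if [v] is between two points of the hull, writing both as a combination of
    [v] and of a point of the hull of the others solves for [v] in the latter
    hull, unless both have weight 1 on [v]. *)
Lemma convex_hull_vertices (s : seq 'cV[R]_d) : exists s' : seq 'cV[R]_d,
  convex_hull [set` s'] = convex_hull [set` s] /\
  forall v, v \in s' -> vertex (convex_hull [set` s]) v.
Proof.
have [m] := ubnP (size s); elim: m s => // m IH s sm.
have [[v [vs hv]]|nredundant] := pselect (exists v, v \in s /\
    convex_hull [set` rem v s] v).
  have [|s' [s'E s'v]] := IH (rem v s).
    by rewrite size_rem //; case: (s) vs sm.
  suff E : convex_hull [set` rem v s] = convex_hull [set` s].
    by exists s'; rewrite -E.
  apply/seteqP; split; first by apply: subset_convex_hull => x /= /mem_rem.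
  apply: convex_hull_min; first exact: convex_hull_convex.
  move=> x /= xs; have [->//|xv] := eqVneq x v.
  apply: sub_convex_hull => /=.
  by move: xs; rewrite (perm_mem (perm_to_rem vs)) inE (negPf xv).
exists s; split=> // v vs; split; first exact: sub_convex_hull.
have hv : ~ convex_hull [set` rem v s] v by move=> hv; apply: nredundant; exists v.
have sE : [set` s] = v |` [set` rem v s].
  by rewrite -set_consE; apply/seteqP; split=> x /=; rewrite (perm_mem (perm_to_rem vs)).
have [[r0 r0s]|rem0] := pselect ([set` rem v s] !=set0); last first.
  have -> : convex_hull [set` s] = [set v].
    rewrite -convex_hull_seq1 sE set_consE; congr (convex_hull (_ `|` _)).
    by apply/seteqP; split=> x //= xs; case: rem0; exists x.
  by move=> a b t -> ->.
move=> a b t Pa Pb /andP[t0 t1] vE.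
have ne0 : [set` rem v s] !=set0 by exists r0.
rewrite sE in Pa Pb.
have [[al a'] [/= /[!in_itv]/= /andP[al0 al1] a'h] aE] := convex_hull_setU1 ne0 Pa.
have [[be b'] [/= /[!in_itv]/= /andP[be0 be1] b'h] bE] := convex_hull_setU1 ne0 Pb.
(* weights that a and b put on the hull of the other points *)
set k1 := t * (1 - al); set k2 := (1 - t) * (1 - be).
have k10 : 0 <= k1 by rewrite mulr_ge0 ?subr_ge0 // ltW.
have k20 : 0 <= k2 by rewrite mulr_ge0 ?subr_ge0 // ltW.
have kv : (k1 + k2) *: v = k1 *: a' + k2 *: b'.
  apply/matrixP => i j; have /matrixP/(_ i j) := vE.
  by rewrite -aE -bE !mxE /= /k1 /k2; lra.
have [k0|k0] := eqVneq (k1 + k2) 0.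
  have k1z : k1 = 0 by lra.
  have k2z : k2 = 0 by lra.
  have al_1 : al = 1.
    by apply/eqP; move/eqP: k1z; rewrite mulf_eq0 (gt_eqF t0) /= subr_eq0 eq_sym.
  have be_1 : be = 1.
    apply/eqP; move/eqP: k2z.
    by rewrite mulf_eq0 subr_eq0 (gt_eqF t1) /= subr_eq0 eq_sym.
  by rewrite -aE -bE /= al_1 be_1 subrr !scale0r !addr0 !scale1r.
case: hv.
have vab : v = (k1 / (k1 + k2)) *: a' + (1 - k1 / (k1 + k2)) *: b'.
  apply: (scalerI k0); rewrite kv scalerDr !scalerA.
  by congr (_ *: _ + _ *: _); field.
rewrite [X in convex_hull _ X]vab; apply: convex_hull_convex => //.
have k0p : 0 < k1 + k2 by rewrite lt_neqAle eq_sym k0 addr_ge0.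
by rewrite ler_pdivrMr // mul1r lerDl k20 divr_ge0 ?(ltW k0p).
Qed.

End Convexity.

(** * Nearest points and the Hausdorff distance *)

Section Hausdorff.
Variables (R : realType) (d : nat).
Implicit Types (p q u v w x y z : 'cV[R]_d) (M t : R) (X W P Z : set 'cV[R]_d).

Lemma projP x W : compact W -> W !=set0 ->
  W (proj x W) /\ forall w, W w -> enorm (x - proj x W) <= enorm (x - w).
Proof.
move=> cptW W0; rewrite /proj; case: xgetP => [y _ []//|noy].
have [|y /[!inE] Wy ymin] := @compact_EVT_min _ _ (fun w => enorm (x - w)) W W0 cptW.
  by apply: continuous_subspaceT => w; exact: continuous_enormB.
by case: (noy y); split=> // w Ww; apply: ymin; rewrite inE.
Qed.

(** Moving from the nearest point [q] towards [y] does not decrease the distance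
    to [x]; compare to first order. *)
Lemma proj_obtuse x y W : compact W -> convexset W -> W y ->
  dot (x - proj x W) (y - proj x W) <= 0.
Proof.
move=> cptW cW Wy; have W0 : W !=set0 by exists y.
have [Wq qmin] := projP x cptW W0; set q := proj x W in Wq qmin *.
set a := dot _ _; set b := dot (y - q) (y - q).
have key t : 0 < t <= 1 -> 2 * a <= t * b.
  move=> /andP[t0 t1]; have := qmin _ (cW _ _ t Wy Wq _).
  rewrite (ltW t0) t1 => /(_ isT).
  rewrite enorm_le ?enorm_ge0 // sqr_enorm.
  have -> : x - (t *: y + (1 - t) *: q) = (x - q) - t *: (y - q).
    by apply/matrixP => i j; rewrite !mxE; ring.
  rewrite [X in _ <= X](_ : _ = dot (x - q) (x - q) + t * (t * b - 2 * a)); last first.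
    by rewrite /a /b !(dotDl (x - q)) !(dotDr _ (x - q)) !dotNl !dotNr !dotZl !dotZr
      (dotC (y - q) (x - q)); ring.
  by rewrite lerDl pmulr_rge0 // subr_ge0.
have b0 : 0 <= b := dot_ge0 _.
rewrite leNgt; apply/negP => a0.
(* a parameter in ]0, 1] for which t * b < 2 * a, also when b = 0 *)
have := key 1; have := key (a / (a + b)).
rewrite ltr01 lexx mul1r divr_gt0 ?ler_pdivrMr ?mul1r ?lerDl ?ltr_wpDr //= => /(_ b0).
rewrite mulrAC ler_pdivlMr ?ltr_wpDr // => /[swap] /(_ isT); nra.
Qed.

Lemma dist_set_le x w W : W w -> dist_set x W <= enorm (x - w).
Proof.
move=> Ww; apply: ge_inf; last by exists w.
by exists 0 => _ [z _ <-]; exact: enorm_ge0.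
Qed.

Lemma dist_set_proj x W : compact W -> W !=set0 ->
  dist_set x W = enorm (x - proj x W).
Proof.
move=> cptW W0; have [Wq qmin] := projP x cptW W0.
apply/eqP; rewrite eq_le dist_set_le //= lb_le_inf //.
  by case: W0 => w Ww; exists (enorm (x - w)), w.
by move=> _ [w Ww <-]; exact: qmin.
Qed.

(** The points at distance at most [M] from [W], up to the attainment of the
    infimum: having a witness in [W] makes bounds on distances to [W] pass to
    convex hulls without any reference to [inf]. *)
Definition thickening W M : set 'cV[R]_d :=
  [set x | exists2 w, W w & enorm (x - w) <= M].

Lemma thickening_convex W M : 0 <= M -> convexset W -> convexset (thickening W M).
Proof.
move=> M0 cW x y t [v Wv xv] [w Ww yw] t01.
exists (t *: v + (1 - t) *: w); first exact: cW.
have -> : t *: x + (1 - t) *: y - (t *: v + (1 - t) *: w) =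
    t *: (x - v) + (1 - t) *: (y - w).
  by apply/matrixP => i j; rewrite !mxE; ring.
rewrite enorm_le // dot_comb; rewrite enorm_le // in xv; rewrite enorm_le // in yw.
have := dot_ge0 (x - v - (y - w)); move/andP: t01 => [t0 t1].
have t10 : 0 <= 1 - t by rewrite subr_ge0.
have := mulr_ge0 t0 t10.
set A := dot (x - v) _ in xv *; set B := dot (y - w) _ in yw *.
set C := dot _ _ => tt C0.
have tA : t * A <= t * M ^+ 2 by rewrite ler_wpM2l.
have tB : (1 - t) * B <= (1 - t) * M ^+ 2 by rewrite ler_wpM2l.
have tC : 0 <= t * (1 - t) * C by rewrite mulr_ge0.
lra.
Qed.

Lemma hausdorff_dist_le P Z M : P !=set0 -> Z !=set0 ->
  P `<=` thickening Z M -> Z `<=` thickening P M -> hausdorff_dist P Z <= M.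
Proof.
move=> [p0 Pp0] [z0 Zz0] PZ ZP; rewrite /hausdorff_dist ge_max.
apply/andP; split; apply: ge_sup.
- by exists (dist_set p0 Z), p0.
- by move=> _ [x /PZ[w Zw xw] <-]; exact: le_trans (dist_set_le _ Zw) xw.
- by exists (dist_set z0 P), z0.
- by move=> _ [x /ZP[w Zw xw] <-]; exact: le_trans (dist_set_le _ Zw) xw.
Qed.

Lemma compact_enormB_max x W : compact W -> W !=set0 ->
  exists2 v, W v & forall w, W w -> enorm (x - w) <= enorm (x - v).
Proof.
move=> cptW W0.
have [|y /[!inE] Wy ymax] := @compact_EVT_max _ _ (fun w => enorm (x - w)) W W0 cptW.
  by apply: continuous_subspaceT => w; exact: continuous_enormB.
by exists y => // w Ww; apply: ymax; rewrite inE.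
Qed.

Lemma dist_set_sup x P Z : compact P -> compact Z -> Z !=set0 -> P x ->
  enorm (x - proj x Z) <= sup [set dist_set p Z | p in P].
Proof.
move=> cptP cptZ Z0 Px; rewrite -dist_set_proj //.
apply: ub_le_sup; last by exists x.
have [z Zz] := Z0.
have [|v _ vmax] := compact_enormB_max z cptP; first by exists x.
exists (enorm (z - v)) => _ [p Pp <-].
by rewrite (le_trans (dist_set_le _ Zz)) // enormBC vmax.
Qed.

Lemma hausdorff_dist_gel p P Z : compact P -> compact Z -> Z !=set0 -> P p ->
  enorm (p - proj p Z) <= hausdorff_dist P Z.
Proof. by move=> *; rewrite le_max dist_set_sup. Qed.

Lemma hausdorff_dist_ger z P Z : compact P -> compact Z -> P !=set0 -> Z z ->
  enorm (z - proj z P) <= hausdorff_dist P Z.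
Proof. by move=> *; rewrite le_max dist_set_sup ?orbT. Qed.

(** The bound [M] is strictly below [D], as the strict inequality has to survive
    the supremum over the hull. *)
Lemma convex_hull_thickening (s : seq 'cV[R]_d) W D : 0 < D -> convexset W ->
  (forall v, v \in s -> exists2 w, W w & enorm (v - w) < D) ->
  exists M, [/\ 0 <= M, M < D & convex_hull [set` s] `<=` thickening W M].
Proof.
move=> D0 cW sW; suff [M [M0 MD sM]] : exists M, [/\ 0 <= M, M < D &
    forall v, v \in s -> thickening W M v].
  exists M; split=> //; apply: convex_hull_min => //.
  exact: thickening_convex.
elim: s sW => [|v s IH] sW; first by exists 0; split.
have [|M [M0 MD sM]] := IH; first by move=> u us; apply: sW; rewrite inE us orbT.
have [|w Ww vw] := sW v; first by rewrite mem_head.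
exists (Num.max M (enorm (v - w))); split.
- by rewrite le_max M0.
- by rewrite gt_max MD.
- move=> u; rewrite inE => /orP[/eqP->|/sM[z Wz uz]].
    by exists w => //; rewrite le_max lexx orbT.
  by exists z => //; rewrite le_max uz.
Qed.

Lemma hausdorff_dist_lt (s s' : seq 'cV[R]_d) D : 0 < D ->
  let P := convex_hull [set` s] in let Z := convex_hull [set` s'] in
  P !=set0 -> Z !=set0 ->
  (forall v, v \in s -> exists2 w, Z w & enorm (v - w) < D) ->
  (forall w, w \in s' -> exists2 v, P v & enorm (w - v) < D) ->
  hausdorff_dist P Z < D.
Proof.
move=> D0 P Z P0 Z0 sZ s'P.
have [M [M0 MD PM]] := convex_hull_thickening D0 (@convex_hull_convex _ _ _) sZ.
have [N [N0 ND ZN]] := convex_hull_thickening D0 (@convex_hull_convex _ _ _) s'P.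
apply: (@le_lt_trans _ _ (Num.max M N)); last by rewrite gt_max MD.
apply: hausdorff_dist_le => // x.
  by move=> /PM[w Zw xw]; exists w => //; rewrite le_max xw.
by move=> /ZN[w Zw xw]; exists w => //; rewrite le_max xw orbT.
Qed.

(** Let [p] and [p'] be the points of [P] nearest to [w] and [z].  Then
    [z - w = (z - p') + (p' - p) - (w - p)], where [|z - p'| <= |w - p|] as [w]
    is farthest from [P] and [<w - p, p' - p> <= 0] as [p] is nearest to [w]. *)
Lemma sup_dist_normal P Z w : compact P -> compact Z -> convexset P -> P !=set0 ->
  Z w -> enorm (w - proj w P) = hausdorff_dist P Z ->
  forall z, Z z -> dot (w - proj w P) (z - w) <= 0.
Proof.
move=> cptP cptZ cP P0 Zw wD z Zz.
have [Pp _] := projP w cptP P0; have [Pp' _] := projP z cptP P0.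
have := hausdorff_dist_ger cptP cptZ P0 Zz.
have := proj_obtuse w cptP cP Pp'.
rewrite -wD enorm_le ?enorm_ge0 // sqr_enorm.
set p := proj w P; set p' := proj z P.
have -> : z - w = (p' - p) + ((z - p') - (w - p)) by apply/matrixP => i j; rewrite !mxE; ring.
move: (p' - p) (w - p) (z - p') => a b c ba cb.
have := dot_ge0 (b - c); rewrite !dotE (dotC c b); lra.
Qed.

End Hausdorff.

(** * Zonotopes with generators in general position *)

Section Zonotope.
Variables (R : realType) (d n : nat).
Implicit Types (Q : 'M[R]_(d, n)) (mu c : 'cV[R]_d) (e x : 'cV[R]_n).

Definition cube_vertex (S : {set 'I_n}) : 'cV[R]_n := \col_j (j \in S)%:R.

Lemma unit_cube_vertex S : unit_cube R n (cube_vertex S).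
Proof. by move=> j; rewrite mxE; case: (j \in S); rewrite /= ?lexx ler01. Qed.

Lemma unit_cube_convex : convexset (unit_cube R n).
Proof.
move=> x y t xI yI /andP[t0 t1] j; rewrite !mxE.
by have /andP[? ?] := xI j; have /andP[? ?] := yI j; nra.
Qed.

(** The cube is the hull of its vertices, by induction on the number [m] of
    coordinates that may differ from 0 and 1: [e] is a combination, with weights
    [e_m] and [1 - e_m], of two points whose [m]-th coordinates are 1 and 0. *)
Lemma unit_cube_sub (W : set 'cV[R]_n) : convexset W ->
  (forall S, W (cube_vertex S)) -> unit_cube R n `<=` W.
Proof.
move=> cW Wv.
suff H m e : unit_cube R n e ->
    (forall j : 'I_n, (m <= j)%N -> e j ord0 = 0 \/ e j ord0 = 1) -> W e.
  move=> e /(H n) ; apply=> j; by rewrite leqNgt ltn_ord.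
elim: m e => [|m IH] e eI e01.
  suff -> : e = cube_vertex [set j | e j ord0 == 1] by [].
  apply/matrixP => j k; rewrite ord1 !mxE inE.
  by have [->|->] := e01 j (leq0n j); rewrite ?eqxx // eq_sym oner_eq0.
have [mn|nm] := ltnP m n; last first.
  by apply: IH => // j mj; have := leq_trans nm mj; rewrite leqNgt ltn_ord.
pose f (b : R) : 'cV[R]_n :=
  \col_j if j == Ordinal mn then b else e j ord0.
have fW (b : bool) : W (f b%:R).
  apply: IH => j; rewrite mxE; case: eqP => [_|jm].
  - by case: b; rewrite lexx ler01.
  - exact: eI.
  - by case: b => _; [right|left].
  - move=> mj; apply: e01; rewrite ltn_neqAle mj andbT.
    by apply/eqP => mjE; apply: jm; apply: val_inj.
have -> : e = e (Ordinal mn) ord0 *: f 1 + (1 - e (Ordinal mn) ord0) *: f 0.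
  apply/matrixP => j k; rewrite ord1 !mxE; case: eqP => [->|_]; ring.
exact: cW (fW true) (fW false) (eI _).
Qed.

Lemma zonotope_hull Q mu : zonotope Q mu =
  convex_hull [set` [seq Q *m cube_vertex A + mu | A : {set 'I_n}]].
Proof.
apply/seteqP; split.
  move=> _ [e eI <-]; move: e eI.
  set X := convex_hull _.
  apply: (@unit_cube_sub (fun e => X (Q *m e + mu))) => [x y t Wx Wy t01|S] /=.
    have -> : Q *m (t *: x + (1 - t) *: y) + mu =
        t *: (Q *m x + mu) + (1 - t) *: (Q *m y + mu).
      rewrite mulmxDr -!scalemxAr; apply/matrixP => i j; rewrite !mxE; ring.
    exact: convex_hull_convex.
  by apply: sub_convex_hull => /=; apply/mapP; exists S; rewrite ?mem_enum.
apply: convex_hull_min => [_ _ t [x xI <-] [y yI <-] t01|_ /= /mapP[S _ ->]].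
  exists (t *: x + (1 - t) *: y); first exact: unit_cube_convex.
  rewrite mulmxDr -!scalemxAr; apply/matrixP => i j; rewrite !mxE; ring.
by exists (cube_vertex S) => //; exact: unit_cube_vertex.
Qed.

Lemma zonotope_liftP Q mu q : zonotope Q mu q ->
  unit_cube R n (zonotope_lift Q mu q) /\ Q *m zonotope_lift Q mu q + mu = q.
Proof.
by move=> [e eI eq]; rewrite /zonotope_lift; case: xgetP => [//|/(_ e)[]].
Qed.

Lemma dot_mulmx Q c x : dot c (Q *m x) = \sum_j x j ord0 * dot c (col j Q).
Proof.
rewrite /dot; under eq_bigr do rewrite mxE mulr_sumr.
rewrite exchange_big; apply: eq_bigr => j _; rewrite mulr_sumr.
by apply: eq_bigr => i _; rewrite mxE; ring.
Qed.

Lemma free_image_sum0 (vT : vectType R) (f : 'I_n -> vT) (S : {set 'I_n}) (k : 'I_n -> R) :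
  free [seq f j | j in S] -> \sum_(j in S) k j *: f j = 0 ->
  forall j, j \in S -> k j = 0.
Proof.
move=> fr k0 j jS.
have jS' : j \in enum S by rewrite mem_enum.
have szE : size [seq f j | j in S] = size (enum S) by rewrite size_map.
have ltj : (index j (enum S) < size [seq f j | j in S])%N by rewrite szE index_mem.
have /(freeP (X := in_tuple _))/(_ (fun i => k (nth j (enum S) i))) := fr.
move=> /(_ _ (Ordinal ltj)) /=; rewrite nth_index //; apply.
rewrite -[RHS]k0 -[RHS]big_enum /= [RHS](big_nth j) big_mkord -szE.
by apply: eq_bigr => i _; rewrite (nth_map j) // -szE.
Qed.

(** Otherwise [c] is orthogonal to [d] independent vectors, hence to itself. *)
Lemma general_position_orthogonal Q c (S : {set 'I_n}) : general_position Q ->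
  c != 0 -> (forall j, j \in S -> dot c (col j Q) = 0) -> (#|S| < d)%N.
Proof.
move=> gp c0 Sc; rewrite ltnNge; apply/negP => /card_geqP[s [us sd sS]].
pose T := [set j in s].
have cT : #|T| = d by rewrite cardsE (card_uniqP us).
have fr := gp T; rewrite cT in fr; move: {fr}(fr (leqnn d)) => fr.
have full : <<[seq col j Q | j in T]>>%VS = fullv.
  apply/eqP; rewrite eqEdim subvf dimvf /dim /= muln1.
  by move: fr; rewrite /free size_map -cardE cT => /eqP ->.
have := coord_span (X := in_tuple [seq col j Q | j in T]) (v := c).
rewrite full memvf => /(_ isT) cE.
case/negP: c0; rewrite -dot_eq0 {2}cE.
rewrite [dot _ _](_ : _ = 0) //.
apply: (big_ind (fun u => dot c u = 0)) => [|u v cu cv|i _].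
- by rewrite dotC dot0l.
- by rewrite dotDr cu cv addr0.
- rewrite dotZr.
  have : (in_tuple [seq col j Q | j in T])`_i \in [seq col j Q | j in T].
    by rewrite mem_nth.
  by move=> /mapP[j]; rewrite mem_enum inE => /sS jS ->; rewrite Sc // mulr0.
Qed.

(** The difference [<c, Q x> - <c, Q e>] is the sum of the
    [(x_j - e_j) <c, g_j>], each nonpositive because replacing the single
    coordinate [e_j] by [x_j] stays in the cube.  The sum is 0, so [x] and [e]
    agree outside the set [S] of the generators orthogonal to [c], and those
    are independent. *)
Lemma general_position_lift_unique Q c e x : general_position Q -> c != 0 ->
  unit_cube R n e ->
  (forall y, unit_cube R n y -> dot c (Q *m y) <= dot c (Q *m e)) ->
  unit_cube R n x -> Q *m x = Q *m e -> x = e.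
Proof.
move=> gp c0 eI emax xI Qx.
pose h j := dot c (col j Q); pose g j := (x j ord0 - e j ord0) * h j.
have g_le0 j : g j <= 0.
  have yI : unit_cube R n (e + (x j ord0 - e j ord0) *: delta_mx j ord0).
    move=> i; rewrite !mxE eqxx andbT; have [->|_] := eqVneq i j.
      by rewrite mulr1 subrKC.
    by rewrite mulr0 addr0.
  have := emax _ yI; rewrite mulmxDr -scalemxAr -colE dotDr dotZr.
  by rewrite gerDl.
have g_sum : \sum_j g j = 0.
  rewrite /g; under eq_bigr do rewrite mulrBl.
  by rewrite sumrB -!dot_mulmx Qx subrr.
have g0 j : g j = 0.
  apply/eqP; rewrite -oppr_eq0; apply/eqP.
  apply: (@psumr_eq0P _ _ xpredT (fun j => - g j)) => // [i _|].
    by rewrite oppr_ge0.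
  by rewrite sumrN g_sum oppr0.
pose S := [set j | h j == 0]%SET.
have xeS j : j \notin S -> x j ord0 = e j ord0.
  rewrite inE => hj; apply/eqP; rewrite -subr_eq0.
  by have /eqP := g0 j; rewrite mulf_eq0 (negPf hj) orbF.
have SltD : (#|S| < d)%N.
  by apply: general_position_orthogonal gp c0 _ => j; rewrite inE => /eqP.
have sum0 : \sum_(j in S) (x j ord0 - e j ord0) *: col j Q = 0.
  have Qxe : Q *m (x - e) = 0 by rewrite mulmxBr Qx subrr.
  rewrite -[RHS]Qxe; apply/matrixP => i k; rewrite mxE summxE big_mkcond /=.
  apply: eq_bigr => j _; rewrite !mxE (_ : k = ord0) ?ord1 //.
  by case: ifPn => [_|/xeS ->]; [rewrite mulrC | rewrite subrr mulr0].
apply/matrixP => j k; rewrite ord1.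
have [jS|/xeS//] := boolP (j \in S).
by apply/eqP; rewrite -subr_eq0; apply/eqP;
  apply: free_image_sum0 (gp S (ltnW SltD)) sum0 j jS.
Qed.

(** The lift of such a point is unique, so that a decomposition of the point in
    the zonotope lifts to a decomposition of the vertex of the cube. *)
Lemma general_position_vertex Q mu c S : general_position Q -> c != 0 ->
  (forall z, zonotope Q mu z -> dot c (z - (Q *m cube_vertex S + mu)) <= 0) ->
  vertex (zonotope Q mu) (Q *m cube_vertex S + mu) /\
  zonotope_lift Q mu (Q *m cube_vertex S + mu) = cube_vertex S.
Proof.
move=> gp c0 cmax; set w := _ + mu.
have SI := unit_cube_vertex S.
have Zw : zonotope Q mu w by exists (cube_vertex S).
have uniq x : unit_cube R n x -> Q *m x + mu = w -> x = cube_vertex S.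
  move=> xI /addIr; apply: general_position_lift_unique gp c0 SI _ xI => y yI.
  have := cmax (Q *m y + mu); rewrite opprD addrACA subrr addr0 dotDr dotNr subr_le0.
  by apply; exists y.
split; last by have [? ?] := zonotope_liftP Zw; exact: uniq.
split=> // _ _ t [a aI <-] [b bI <-] /andP[t0 t1] wE.
have abE : t *: a + (1 - t) *: b = cube_vertex S.
  apply: uniq; first by apply: unit_cube_convex; rewrite // !ltW.
  by rewrite wE mulmxDr -!scalemxAr; apply/matrixP => i j; rewrite !mxE; ring.
suff [-> ->] : a = cube_vertex S /\ b = cube_vertex S by [].
suff H j : a j ord0 = cube_vertex S j ord0 /\ b j ord0 = cube_vertex S j ord0.
  by split; apply/matrixP => j k; rewrite ord1; have [] := H j.
have /matrixP/(_ j ord0) := abE; rewrite !mxE.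
have /andP[a0 a1] := aI j; have /andP[b0 b1] := bI j.
by case: (j \in S) => /= E; split; apply/eqP; rewrite eq_le; apply/andP; split=> //; nra.
Qed.

End Zonotope.

(** * The improving cone *)

Section Cone.
Variables (R : realType) (d n : nat).

Definition lift_form (e : 'cV[R]_n) (v : 'cV[R]_d) (D : 'M[R]_(d, n) * 'cV[R]_d) : R :=
  dot (D.1 *m e + D.2) v.

Fact lift_form_is_linear e v : GRing.linear_for *%R (lift_form e v).
Proof.
move=> a D E; rewrite /lift_form /= mulmxDl -scalemxAl !dotE; ring.
Qed.

HB.instance Definition _ e v := GRing.isLinear.Build R
  ('M[R]_(d, n) * 'cV[R]_d)%type R *%R (lift_form e v) (lift_form_is_linear e v).

Lemma improving_cone_polyhedral k (e : 'I_k -> 'cV[R]_n) (p q : 'I_k -> 'cV[R]_d) :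
  polyhedral_cone (improving_cone e p q).
Proof. by exists k, (fun i => lift_form (e i) (p i - q i)). Qed.

Lemma near_interior (V : normedModType R) (C : set V) x u : C° x ->
  \forall t \near 0^'+, C (x + t *: u).
Proof.
move=> Cx; have cvgx : (fun t : R => x + t *: u) @ 0^'+ --> x + 0 *: u.
  apply: cvg_at_right_filter; apply: cvgD; first exact: cvg_cst.
  by apply: cvgZr_tmp; exact: cvg_id.
by rewrite scale0r addr0 in cvgx; exact: cvgx.
Qed.

(** From an interior point it is possible to move [Dmu] a little in the direction
    [- (p i - q i)] without leaving the cone, which lowers the [i]-th form by a
    positive multiple of [|p i - q i|^2]. *)
Lemma improving_cone_interior k (e : 'I_k -> 'cV[R]_n) (p q : 'I_k -> 'cV[R]_d)
    DQ Dmu i : (improving_cone e p q)° (DQ, Dmu) -> p i != q i ->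
  0 < dot (DQ *m e i + Dmu) (p i - q i).
Proof.
move=> /near_interior-/(_ (0, - (p i - q i))) Ct pq.
have pq0 : 0 < dot (p i - q i) (p i - q i).
  by rewrite lt_neqAle dot_ge0 eq_sym dot_eq0 subr_eq0 pq.
have [t [t0 /(_ i)]] : exists t : R, 0 < t /\
    improving_cone e p q ((DQ, Dmu) + t *: (0, - (p i - q i))).
  apply: (@filter_ex _ (0 : R)^'+); near=> t; split; last by near: t.
  by near: t; exact: nbhs_right_gt.
rewrite /= scaler0 addr0 addrA dotDl dotZl dotNl; have := mulr_gt0 t0 pq0; lra.
Unshelve. all: by end_near. Qed.

End Cone.

(** * A polytope with two points is not stable relative to itself *)

Section Positivity.
Variables (R : realType) (d : nat).

(** Take [v] farthest from [a]: it is a vertex by strict convexity of the norm,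
    and it is not interior since it could be moved away from [a].  Its nearest
    point is itself, so stability would put 0 in the relative interior of the
    normal cone at [v].  That cone contains [c = v - a], hence it would contain
    [- t c] for some [t > 0], whereas [<- t c, a - v> = t |c|^2 > 0]. *)
Lemma convex_hull_farthest_not_stable (s : seq 'cV[R]_d) a b :
  let X := convex_hull [set` s] in X a -> X b -> a != b ->
  exists v, vertex X v /\ ~ hausdorff_stable X v.
Proof.
move=> X Xa Xb ab.
have X0 : X !=set0 by exists a.
have cptX : compact X by exact: convex_hull_seq_compact.
have cX : convexset X := @convex_hull_convex _ _ _.
have [v Xv vmax] := compact_enormB_max a cptX X0.
pose c := v - a.
have vmax' w : X w -> dot (w - a) (w - a) <= dot c c.
  by move=> /vmax; rewrite !(enormBC a) enorm_le ?enorm_ge0 // sqr_enorm.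
have c0 : 0 < dot c c.
  apply: lt_le_trans (vmax' b Xb).
  by rewrite lt_neqAle dot_ge0 eq_sym dot_eq0 subr_eq0 eq_sym ab.
exists v; split.
  split=> // x y t Xx Xy /andP[t0 t1] vE.
  have xy : x = y.
    apply/eqP; rewrite -subr_eq0 -dot_eq0 eq_le dot_ge0 andbT.
    have := vmax' x Xx; have := vmax' y Xy.
    have -> : c = t *: (x - a) + (1 - t) *: (y - a).
      by rewrite /c vE; apply/matrixP => i j; rewrite !mxE; ring.
    rewrite dot_comb (_ : x - a - (y - a) = x - y); last first.
      by apply/matrixP => i j; rewrite !mxE; ring.
    have := dot_ge0 (x - y).
    set A := dot (x - a) _; set B := dot (y - a) _; set D := dot (x - y) _.
    move=> D0 BE AE.
    have t10 : 0 < 1 - t by rewrite subr_gt0.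
    have tA : t * A <= t * (t * A + (1 - t) * B - t * (1 - t) * D).
      by rewrite ler_pM2l.
    have tB : (1 - t) * B <= (1 - t) * (t * A + (1 - t) * B - t * (1 - t) * D).
      by rewrite ler_pM2l.
    have tD : t * (1 - t) * D <= 0 by lra.
    by rewrite pmulr_rle0 ?mulr_gt0 // in tD.
  by rewrite vE xy -scalerDl subrKC scale1r.
move=> [vint|[_]].
  have [t [t0 Xt]] : exists t : R, 0 < t /\ X (v + t *: c).
    apply: (@filter_ex _ (0 : R)^'+); near=> t; split; last first.
      by near: t; exact: near_interior.
    by near: t; exact: nbhs_right_gt.
  have := vmax' _ Xt; rewrite (_ : v + t *: c - a = (1 + t) *: c); last first.
    by rewrite /c; apply/matrixP => i j; rewrite !mxE; ring.
  by rewrite dotZl dotZr => ?; nra.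
have [Xp pmin] := projP v cptX X0.
have pv : proj v X = v.
  apply/eqP; rewrite eq_sym -subr_eq0; apply/eqP/enorm_le0.
  by have := pmin _ Xv; rewrite subrr enorm0.
rewrite pv subrr => -[_ [eps eps0 relint]].
have cN : normal_cone X v c.
  move=> x Xx; have -> : x - v = (x - a) - c by rewrite /c opprB addrA subrK.
  have := vmax' x Xx; move: (x - a) (c) => y z yz.
  by have := dot_ge0 (z - y); rewrite !dotE (dotC y z); lra.
have [t [t0 tc]] : exists t : R, 0 < t /\ enorm (0 - t *: c) < eps.
  apply: (@filter_ex _ (0 : R)^'+); near=> t; split; last first.
    by near: t; apply: enorm_descent => //; left; rewrite enorm0.
  by near: t; exact: nbhs_right_gt.
rewrite sub0r in tc.
have : normal_cone X v (- (t *: c)).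
  apply: relint; last by rewrite subr0.
  (* - t c = (1 + t) 0 + (- t) c is in the affine hull of the normal cone *)
  exists 2%N, (fun i => if i == ord0 then 1 + t else - t),
    (fun i => if i == ord0 then 0 else c).
  split=> [i||]; rewrite ?big_ord_recl ?big_ord0 //=.
  - by case: eqP => // _ x _; rewrite dot0l.
  - by ring.
  - by rewrite scaler0 add0r addr0 scaleNr.
move=> /(_ a Xa); rewrite -(opprB v a) -/c dotNl dotNr dotZl opprK.
by have := mulr_gt0 t0 c0; lra.
Unshelve. all: by end_near. Qed.

End Positivity.

(** If the distance is 0, then [P = Z], which is not stable relative to itself. *)
Lemma hausdorff_dist_gt0 (R : realType) (d : nat) (s : seq 'cV[R]_d)
    (Z : set 'cV[R]_d) (a b : 'cV[R]_d) :
  let P := convex_hull [set` s] in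
  P !=set0 -> compact Z -> Z a -> Z b -> a != b ->
  (forall v, vertex P v -> hausdorff_stable Z v) ->
  0 < hausdorff_dist P Z.
Proof.
move=> P P0 cptZ Za Zb ab stable.
have Z0 : Z !=set0 by exists a.
have cptP : compact P by exact: convex_hull_seq_compact.
rewrite ltNge; apply/negP => D0.
have PZ : P = Z.
  apply/seteqP; split=> x Xx.
    have /enorm_le0/eqP := le_trans (hausdorff_dist_gel cptP cptZ Z0 Xx) D0.
    by rewrite subr_eq0 => /eqP ->; have [] := projP x cptZ Z0.
  have /enorm_le0/eqP := le_trans (hausdorff_dist_ger cptP cptZ P0 Xx) D0.
  by rewrite subr_eq0 => /eqP ->; have [] := projP x cptP P0.
rewrite -PZ in Za Zb stable.
by have [v [/stable + nst]] := convex_hull_farthest_not_stable Za Zb ab.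
Qed.

(** * First-order perturbation *)

Lemma near_all_seq (T : eqType) (U : Type) (F : set_system U) (s : seq T)
    (A : T -> set U) : Filter F ->
  (forall x, x \in s -> \forall t \near F, A x t) ->
  \forall t \near F, forall x, x \in s -> A x t.
Proof.
move=> FF; elim: s => [|x s IH] sA; first exact: nearW.
have As : \forall t \near F, forall y, y \in s -> A y t.
  by apply: IH => y ys; apply: sA; rewrite inE ys orbT.
near=> t => y; rewrite inE => /orP[/eqP->|].
  by near: t; apply: sA; rewrite mem_head.
by move: y; near: t.
Unshelve. all: by end_near. Qed.

Section Perturbation.
Variables (R : realType) (d n : nat) (s : seq 'cV[R]_d).
Variables (Q : 'M[R]_(d, n)) (mu : 'cV[R]_d) (DQ : 'M[R]_(d, n)) (Dmu : 'cV[R]_d).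
Let P := convex_hull [set` s].
Let Z := zonotope Q mu.
Let D := hausdorff_dist P Z.
Hypotheses (P0 : P !=set0) (D0 : 0 < D).
Hypothesis improving : forall x y, achieves_hausdorff P Z x y ->
  0 < dot (DQ *m zonotope_lift Q mu y + Dmu) (x - y).

Lemma perturbed_pointE t (e : 'cV[R]_n) :
  (Q + t *: DQ) *m e + (mu + t *: Dmu) = Q *m e + mu + t *: (DQ *m e + Dmu).
Proof. by rewrite mulmxDl -scalemxAl scalerDr addrACA. Qed.

Let zonotope_n0 : Z !=set0.
Proof.
exists (Q *m cube_vertex R finset.set0 + mu), (cube_vertex R finset.set0) => //.
exact: unit_cube_vertex.
Qed.

Let cptP : compact P. Proof. exact: convex_hull_seq_compact. Qed.
Let cptZ : compact Z.
Proof. rewrite /Z zonotope_hull; exact: convex_hull_seq_compact. Qed.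

(** The point of [Z_t] to compare [v] with has the same lift as the point of [Z]
    nearest to [v]. *)
Lemma near_vertex_approach v : vertex P v -> \forall t \near 0^'+,
  exists2 w, zonotope (Q + t *: DQ) (mu + t *: Dmu) w & enorm (v - w) < D.
Proof.
move=> vP; have Pv := vP.1.
have [Zq _] := projP v cptZ zonotope_n0.
set q := proj v Z in Zq.
have [eI eq] := zonotope_liftP Zq; set e := zonotope_lift Q mu q in eI eq.
have : \forall t \near 0^'+, enorm ((v - q) - t *: (DQ *m e + Dmu)) < D.
  apply: enorm_descent => //.
  have := hausdorff_dist_gel cptP cptZ zonotope_n0 Pv.
  rewrite le_eqVlt => /orP[/eqP vD|]; [right; split=> //|by left].
  by apply: improving; split=> //; left.
apply: filterS => t vt; exists (q + t *: (DQ *m e + Dmu)).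
  by exists e => //; rewrite perturbed_pointE eq.
by rewrite opprD addrA.
Qed.

(** Only the cube vertices whose image is at distance [D] need the velocity
    condition, and general position makes these images vertices of [Z] with
    [cube_vertex R A] as lift, that is, members of an achieving pair. *)
Lemma near_cube_vertex_approach A : general_position Q -> \forall t \near 0^'+,
  exists2 v, P v &
    enorm ((Q + t *: DQ) *m cube_vertex R A + (mu + t *: Dmu) - v) < D.
Proof.
move=> gp; set e := cube_vertex R A; set w := Q *m e + mu.
have eI : unit_cube R n e := unit_cube_vertex R A.
have Zw : Z w by exists e.
have [Pp _] := projP w cptP P0; set p := proj w P in Pp.
have : \forall t \near 0^'+, enorm ((p - w) - t *: (DQ *m e + Dmu)) < D.
  apply: enorm_descent => //.
  have := hausdorff_dist_ger cptP cptZ P0 Zw; rewrite -/p.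
  rewrite -/D le_eqVlt enormBC => /orP[/eqP pD|]; [right; split=> //|by left].
  have wp0 : w - p != 0.
    by apply/eqP => wp; move: D0; rewrite -pD enormBC wp enorm0 ltxx.
  have wmax : forall z, Z z -> dot (w - p) (z - w) <= 0.
    apply: sup_dist_normal => //; first exact: convex_hull_convex.
    by rewrite -/p enormBC.
  have [wZ lw] := general_position_vertex gp wp0 wmax.
  by rewrite -[e]lw; apply: improving; split=> //; right.
apply: filterS => t pt; exists p => //.
by rewrite perturbed_pointE -/w enormBC opprD addrA.
Qed.

Lemma near_hausdorff_dist_lt : general_position Q ->
  (forall v, v \in s -> vertex P v) -> \forall t \near 0^'+,
  hausdorff_dist P (zonotope (Q + t *: DQ) (mu + t *: Dmu)) < D.
Proof.
move=> gp sv.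
have HP := near_all_seq (at_right_proper_filter 0)
  (fun v vs => near_vertex_approach (sv v vs)).
have HZ := filter_forall (at_right_proper_filter (0 : R))
  (fun A => near_cube_vertex_approach A gp).
near=> t; rewrite zonotope_hull; apply: hausdorff_dist_lt => //.
- exists ((Q + t *: DQ) *m cube_vertex R finset.set0 + (mu + t *: Dmu)).
  by apply: sub_convex_hull => /=; apply/mapP; exists finset.set0; rewrite ?mem_enum.
- by move=> v vs; rewrite -zonotope_hull; move: v vs; near: t.
- by move=> _ /mapP[A _ ->]; move: A; near: t.
Unshelve. all: by end_near. Qed.

End Perturbation.

Theorem proposition5p1 (R : realType) (d n : nat)
    (P : set 'cV[R]_d) (Q : 'M[R]_(d, n)) (mu : 'cV[R]_d)
    (k : nat) (p q : 'I_k -> 'cV[R]_d)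
    (d_gt0 : (0 < d)%N) (n_gt0 : (0 < n)%N)
    (polyP : polytope P)
    (genQ : general_position Q)
    (stableP : forall v, vertex P v -> hausdorff_stable (zonotope Q mu) v)
    (stableZ : forall w, vertex (zonotope Q mu) w -> hausdorff_stable P w)
    (pq_distinct : injective (fun i => (p i, q i)))
    (pq_all : forall x y, achieves_hausdorff P (zonotope Q mu) x y <->
                exists i, x = p i /\ y = q i) :
  let C := improving_cone (fun i => zonotope_lift Q mu (q i)) p q in
  polyhedral_cone C /\
  forall (DQ : 'M[R]_(d, n)) (Dmu : 'cV[R]_d), C° (DQ, Dmu) ->
    exists2 eps : R, 0 < eps &
      forall t : R, 0 < t < eps ->
        hausdorff_dist P (zonotope (Q + t *: DQ) (mu + t *: Dmu)) <
        hausdorff_dist P (zonotope Q mu).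
Proof.
move=> C; split=> [|DQ Dmu Cint]; first exact: improving_cone_polyhedral.
set Z := zonotope Q mu in stableP stableZ pq_all *.
have [V [/finite_seqP[s0 ->] [v0 v0s] PE]] := polyP.
have [s [sE sv]] := convex_hull_vertices s0.
rewrite -PE in sE sv.
have P0 : P !=set0 by exists v0; rewrite PE; exact: sub_convex_hull.
have D0 : 0 < hausdorff_dist P Z.
  (* two distinct points of Z: the images of the origin and of a basis vector *)
  pose a A := Q *m cube_vertex R A + mu.
  have Za A : Z (a A) by exists (cube_vertex R A) => //; exact: unit_cube_vertex.
  pose j := Ordinal n_gt0; have aneq : a [set j]%SET != a finset.set0.
    have colj : col j Q != 0.
      have gj : free [seq col i Q | i in [set j]%SET] by apply: genQ; rewrite cards1.
      by apply: (free_not0 gj); apply/mapP; exists j; rewrite ?mem_enum ?inE.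
    apply: contraNneq colj => /addIr/eqP; rewrite -subr_eq0 -mulmxBr.
    rewrite (_ : _ - _ = delta_mx j ord0) ?colE //.
    by apply/matrixP => i l; rewrite ord1 !mxE !inE subr0 andbT.
  rewrite -sE; apply: hausdorff_dist_gt0 (Za _) (Za _) aneq _; rewrite ?sE //.
  by rewrite /Z zonotope_hull; exact: convex_hull_seq_compact.
have improving x y : achieves_hausdorff P Z x y ->
    0 < dot (DQ *m zonotope_lift Q mu y + Dmu) (x - y).
  move=> xy; have [_ _ xyD _] := xy; have [i [xE yE]] := (pq_all x y).1 xy.
  rewrite xE yE; apply: (improving_cone_interior Cint).
  rewrite -xE -yE -subr_eq0; apply/eqP => xy0.
  by move: D0; rewrite -xyD xy0 enorm0 ltxx.
rewrite -sE in P0 D0 improving sv *.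
have [eps /= eps0 lt] := near_hausdorff_dist_lt P0 D0 improving genQ sv.
exists eps => // t /andP[t0 te]; apply: lt => //=.
by rewrite sub0r normrN gtr0_norm.
Qed.
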